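(* Let $\alpha>-1$, $\beta>-1$, $|\xi|\ge1$ and $M\ge0$. Let $c_0$ be the linear functional associated to the Jacobi measure $(1-x)^{\alpha}(1+x)^{\beta}dx$ on $]-1,1[$, and $c_1$ the one associated to $\frac{(1-x)^{\alpha+1}(1+x)^{\beta+1}}{|x-\xi|}dx+M\delta(\xi)$, where the first part is supported on $]-1,1[$. Let $\mu_{1,n}$ be the smallest zero of the polynomial $A_n(\lambda)$ associated with the coherent pair $(c_0,c_1)$. Then $$\lim_{n\to\infty}\mu_{1,n}=0.$$
   Context: $\delta(\xi)$ is the Dirac measure at $\xi$, so $c_1(p)=\int_{-1}^1p(x)\frac{(1-x)^{\alpha+1}(1+x)^{\beta+1}}{|x-\xi|}dx+Mp(\xi)$. Let $P_n$ (resp. $T_n$) be the monic orthogonal polynomials with respect to $c_0$ (resp. $c_1$), $k_n^{(0)}=c_0(P_n^2)$, $k_n^{(1)}=c_1(T_n^2)$. The pair is coherent: there are real numbers $\sigma_n$, $n\ge1$, with $T_n=\frac{P_{n+1}'}{n+1}-\sigma_n\frac{P_n'}{n}$. The polynomials $A_n$ are defined by $A_0(\lambda)=1$, $A_1(\lambda)=\lambda-\frac{k_1^{(0)}}{k_0^{(1)}}$ and, for $n\ge2$, $$A_n(\lambda)=\Big(\lambda-\frac{k_n^{(0)}}{n^2k_{n-1}^{(1)}}-\frac{\sigma_{n-1}^2}{(n-1)^2}\frac{k_{n-1}^{(0)}}{k_{n-1}^{(1)}}\Big)A_{n-1}(\lambda)-\frac{\sigma_{n-1}^2(k_{n-1}^{(0)})^2}{(n-1)^4k_{n-1}^{(1)}k_{n-2}^{(1)}}A_{n-2}(\lambda).$$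 Their zeros are real and positive. The number $\mu_{1,n}$ arises from the Markov-Bernstein inequality $c_1((p')^2)\le\frac{1}{\mu_{1,n}}c_0(p^2)$ for real polynomials $p$ of degree at most $n$. *)

(* Defs.v *)
From HB Require Import structures.
From mathcomp Require Import all_boot all_order all_algebra.
From mathcomp Require Import all_classical all_reals all_analysis.
Set Implicit Arguments.
Unset Strict Implicit.
Unset Printing Implicit Defensive.
Import Order.TTheory GRing.Theory Num.Theory.
Import numFieldNormedType.Exports.
Local Open Scope classical_set_scope.
Local Open Scope ring_scope.

(* For [x] in the open interval both bases of [`^] are positive. *)
Definition jacobi_functional (R : realType) (alpha beta : R)
    (p : {poly R}) : R :=
  \int[lebesgue_measure]_(x in `]-1, 1[%classic)
    (p.[x] * ((1 - x) `^ alpha * (1 + x) `^ beta)).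

(* The Dirac part is the evaluation at [xi], weighted by the mass [M].  The
   denominator does not vanish on the open interval when [1 <= `|xi|]. *)
Definition jacobi_dirac_functional (R : realType) (alpha beta xi M : R)
    (p : {poly R}) : R :=
  \int[lebesgue_measure]_(x in `]-1, 1[%classic)
    (p.[x] * ((1 - x) `^ (alpha + 1) * (1 + x) `^ (beta + 1) / `|x - xi|))
  + M * p.[xi].

(* [c (P n ^+ 2) != 0] is not required: it is automatic for a positive definite
   functional. *)
Definition monic_orthogonal_polys (R : realType) (c : {poly R} -> R)
    (P : nat -> {poly R}) : Prop :=
  [/\ forall n, P n \is monic,
      forall n, size (P n) = n.+1 &
      forall m n, m != n -> c (P m * P n) = 0].

Definition coherence_relation (R : realType) (P T : nat -> {poly R})
    (sigma : nat -> R) : Prop :=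
  forall n, (0 < n)%N ->
    T n = (n.+1)%:R^-1 *: (P n.+1)^`() - (sigma n / n%:R) *: (P n)^`().

(* In the last clause [m] stands for [n - 2], so that the polynomial being
   defined is [A_n] with [n - 1 = m.+1] and [n = m.+2]. *)
Fixpoint coherent_A (R : realType) (k0 k1 sigma : nat -> R) (n : nat)
    : {poly R} :=
  match n with
  | 0 => 1
  | 1 => 'X - (k0 1%N / k1 0%N)%:P
  | (m.+1 as m1).+1 =>
      ('X - (k0 m.+2 / (m.+2%:R ^+ 2 * k1 m.+1))%:P
          - (sigma m.+1 ^+ 2 / m.+1%:R ^+ 2 * (k0 m.+1 / k1 m.+1))%:P)
        * coherent_A k0 k1 sigma m1
      - ((sigma m.+1 ^+ 2 * k0 m.+1 ^+ 2)
           / (m.+1%:R ^+ 4 * k1 m.+1 * k1 m))%:P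
        * coherent_A k0 k1 sigma m
  end.

Definition is_smallest_zero (R : realType) (p : {poly R}) (z : R) : Prop :=
  root p z /\ forall y, root p y -> z <= y.

(* Main.v *)
Require Import Defs.
From HB Require Import structures.
From mathcomp Require Import all_boot all_order all_algebra.
From mathcomp Require Import all_classical all_reals all_analysis.
From mathcomp Require Import measurable_realfun ring lra.
Import Order.TTheory GRing.Theory Num.Theory.
Import numFieldNormedType.Exports.
Local Open Scope classical_set_scope.
Local Open Scope ring_scope.

(** The coherence relation makes [T_n] the derivative of
    [P_(n+1) / (n+1) - sigma_n P_n / n], so in the basis of these primitives the
    form [c_1 (p'^2)] is diagonal and [c_0 (p^2)] tridiagonal, and [A_n] is the
    characteristic polynomial of the second with respect to the first. Hence its
    smallest zero [mu_n] is positive and is the minimum of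
    [c_0 (p^2) / c_1 (p'^2)] over polynomials of degree at most [n].
    Since [c_1] dominates the Jacobi functional of parameters
    [alpha + 1, beta + 1] divided by [1 + |xi|], testing on [p = (1 + X)^n] and
    integrating the derivative of [(1 - x)^(alpha + 1) (1 + x)^(beta + 2 n)] over
    [[-1, 1]] gives
    [mu_n <= (1 + |xi|) (beta + 2 n) / (n^2 (alpha + 1))], which tends to [0]. *)

Set Implicit Arguments.
Unset Strict Implicit.
Unset Printing Implicit Defensive.

(** * Coherent pairs *)

Section OrthogonalPolys.
Context {R : realType} {c : {scalar {poly R}}} {Q : nat -> {poly R}}.
Hypothesis opQ : monic_orthogonal_polys c Q.

Lemma orthogonal_polys_coef n : (Q n)`_n = 1.
Proof.
have [Qm Qs _] := opQ.
by have /monicP := Qm n; rewrite lead_coefE Qs.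
Qed.

Lemma size_sub_orthogonal_poly n (p : {poly R}) :
  (size p <= n.+1)%N -> (size (p - p`_n *: Q n)%R <= n)%N.
Proof.
have [_ Qs _] := opQ => sp; apply/leq_sizeP => j.
rewrite leq_eqVlt => /predU1P[<-|nj].
  by rewrite coefB coefZ orthogonal_polys_coef mulr1 subrr.
rewrite coefB coefZ (nth_default _ (leq_trans sp nj)).
by rewrite [(Q n)`_j]nth_default ?Qs// mulr0 subrr.
Qed.

(** Peeling off leading terms writes [p] as a combination of the [Q m] with [m < n]. *)
Lemma orthogonal_polys_size_le n (p : {poly R}) :
  (size p <= n)%N -> c (p * Q n) = 0.
Proof.
have [_ _ Qo] := opQ.
suff H m (q : {poly R}) : (m <= n)%N -> (size q <= m)%N -> c (q * Q n) = 0.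
  exact: H.
elim: m q => [|m IHm] q mn sq.
  by move: sq; rewrite leqn0 size_poly_eq0 => /eqP ->; rewrite mul0r linear0.
rewrite -(subrK (q`_m *: Q m) q) mulrDl linearD /=.
rewrite IHm ?(ltnW mn) ?size_sub_orthogonal_poly// add0r.
by rewrite -scalerAl linearZ /= Qo ?mulr0// neq_ltn mn.
Qed.

Lemma orthogonal_polys_lead n (p : {poly R}) :
  (size p <= n.+1)%N -> c (p * Q n) = p`_n * c (Q n ^+ 2).
Proof.
move=> sp; rewrite -{1}(subrK (p`_n *: Q n) p) mulrDl linearD /=.
rewrite orthogonal_polys_size_le ?size_sub_orthogonal_poly// add0r.
by rewrite -scalerAl linearZ /= -expr2.
Qed.

End OrthogonalPolys.

Lemma scalar_sqrDZ (R : comNzRingType) (c : {scalar {poly R}}) b (p q : {poly R}) :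
  c ((p + b *: q) ^+ 2) = c (p ^+ 2) + 2 * b * c (p * q) + b ^+ 2 * c (q ^+ 2).
Proof.
have -> : (p + b *: q) ^+ 2 = p ^+ 2 + (2 * b) *: (p * q) + b ^+ 2 *: q ^+ 2.
  by rewrite -!mul_polyC !polyCM polyC_natr; ring.
by rewrite 2!linearD 2!linearZ.
Qed.

(** * Zeros of [A_n] and Rayleigh quotients *)

Section CoherentPair.
Context {R : realType} {c0 c1 : {scalar {poly R}}}.
Hypothesis c0_gt0 : forall p : {poly R}, p != 0 -> 0 < c0 (p ^+ 2).
Hypothesis c1_gt0 : forall p : {poly R}, p != 0 -> 0 < c1 (p ^+ 2).
Context {P T : nat -> {poly R}} {sigma : nat -> R}.
Hypothesis opP : monic_orthogonal_polys c0 P.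
Hypothesis opT : monic_orthogonal_polys c1 T.
Hypothesis coh : coherence_relation P T sigma.
Let k0 n := c0 (P n ^+ 2).
Let k1 n := c1 (T n ^+ 2).
Let A := coherent_A k0 k1 sigma.
(** Since [A n] is monic of degree [n], this sign makes [S z n] positive far to the left, hence up
    to the smallest zero. *)
Let S (z : R) n := (-1) ^+ n * (A n).[z].

Let c0Z a p : c0 (a *: p) = a * c0 p. Proof. exact: linearZ. Qed.

Let k0_gt0 n : 0 < k0 n.
Proof. by apply: c0_gt0; case: opP => + _ _; move/(_ n)/monic_neq0. Qed.

Let k1_gt0 n : 0 < k1 n.
Proof. by apply: c1_gt0; case: opT => + _ _; move/(_ n)/monic_neq0. Qed.

Let S0 z : S z 0 = 1.
Proof. by rewrite /S /A /= !hornerE. Qed.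

Let S1 z : S z 1 = k0 1%N / k1 0%N - z.
Proof. by rewrite /S /A /= !hornerE /=; ring. Qed.

Let S_rec z n : S z n.+2 =
  (k0 n.+2 / (n.+2%:R ^+ 2 * k1 n.+1) +
   sigma n.+1 ^+ 2 / n.+1%:R ^+ 2 * (k0 n.+1 / k1 n.+1) - z) * S z n.+1
  - sigma n.+1 ^+ 2 * k0 n.+1 ^+ 2 / (n.+1%:R ^+ 4 * k1 n.+1 * k1 n) * S z n.
Proof.
rewrite /S /A [coherent_A _ _ _ n.+2]/= -/(coherent_A k0 k1 sigma n.+1).
by rewrite !hornerE /= !exprS; ring.
Qed.

(* With [a_n = k0_n / (n^2 k1_(n-1))] the recurrence has the form
   [S_n = (a_n + s_n - z) S_(n-1) - s_n a_(n-1) S_(n-2)] with [0 <= s_n], so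
   [S_n >= a_n S_(n-1)] propagates. *)
Lemma coherent_A_sign_le0 (z : R) n : z <= 0 -> 0 < (-1) ^+ n * (A n).[z].
Proof.
move=> z0; rewrite -/(S z n).
suff [] : 0 < S z n /\ k0 n.+1 / (n.+1%:R ^+ 2 * k1 n) * S z n <= S z n.+1 by [].
elim: n => [|n [Sn IHn]].
  by rewrite S0 S1 expr1n mul1r mulr1 lerDl oppr_ge0 ltr01.
have a_gt0 m : 0 < k0 m.+1 / (m.+1%:R ^+ 2 * k1 m).
  by rewrite divr_gt0// mulr_gt0// exprn_gt0// ltr0n.
have Sn1 : 0 < S z n.+1 by apply: lt_le_trans IHn; rewrite mulr_gt0.
split=> //; rewrite S_rec.
set s := sigma n.+1 ^+ 2 / n.+1%:R ^+ 2 * (k0 n.+1 / k1 n.+1).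
have s0 : 0 <= s by rewrite mulr_ge0 ?divr_ge0 ?sqr_ge0// ltW.
have -> : sigma n.+1 ^+ 2 * k0 n.+1 ^+ 2 / (n.+1%:R ^+ 4 * k1 n.+1 * k1 n) =
    s * (k0 n.+1 / (n.+1%:R ^+ 2 * k1 n)).
  rewrite /s; have := k1_gt0 n; have := k1_gt0 n.+1; move=> /gt_eqF K1 /gt_eqF K.
  have : n.+1%:R != 0 :> R by rewrite pnatr_eq0.
  by move: n.+1%:R => N N0; field; rewrite K K1 N0.
have : 0 <= s * (S z n.+1 - k0 n.+1 / (n.+1%:R ^+ 2 * k1 n) * S z n).
  by rewrite mulr_ge0// subr_ge0.
have : 0 <= - z * S z n.+1 by rewrite mulr_ge0 ?oppr_ge0// ltW.
rewrite -subr_ge0 => H1 H2; rewrite -subr_ge0; apply: le_trans (addr_ge0 H1 H2) _.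
by rewrite le_eqVlt; apply/orP; left; apply/eqP; ring.
Qed.

Lemma coherent_A_root_gt0 z n : root (A n) z -> 0 < z.
Proof.
move=> /rootP Az; rewrite ltNge; apply/negP => /(@coherent_A_sign_le0 z n).
by rewrite Az mulr0 ltxx.
Qed.

(** The sign is known at [0], so by the intermediate value theorem a change of sign on [[0, z]]
    would produce a zero below [mu]. *)
Lemma coherent_A_sign_lt z mu n :
  (forall y, root (A n) y -> mu <= y) -> z < mu -> 0 < (-1) ^+ n * (A n).[z].
Proof.
move=> mu_le zmu; have [z0|z0] := leP z 0; first exact: coherent_A_sign_le0.
rewrite ltNge; apply/negP => Sz.
pose p : {poly R} := - ((-1) ^+ n *: A n).
have pE y : p.[y] = - S y n by rewrite /p !hornerE.
have [] := @poly_ivt R p 0 z (ltW z0).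
  rewrite !pE oppr_le0 oppr_ge0 Sz andbT.
  exact/ltW/coherent_A_sign_le0.
move=> y /andP[_ yz]; rewrite /p rootN rootZ ?signr_eq0// => /mu_le muy.
by have := le_lt_trans (le_trans muy yz) zmu; rewrite ltxx.
Qed.

Section SmallestZero.
Variable mu : nat -> R.
Hypothesis muP : forall n, (0 < n)%N -> is_smallest_zero (A n) (mu n).

(** Half of the interlacing of zeros. At the smallest zero of [A n.+1] the recurrence reduces
    [S _ n.+2] to a nonpositive multiple of [S _ n], which is nonnegative there by induction;
    strictly below all zeros of [A n.+2] it would have to be positive. *)
Lemma smallest_zero_nonincreasing n : (0 < n)%N -> mu n.+1 <= mu n.
Proof.
elim: n => // n IHn _; rewrite leNgt; apply/negP => lt_mu.
have Sn : 0 <= S (mu n.+1) n.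
  case: n IHn {lt_mu} => [|n] IHn; first by rewrite S0.
  have := IHn isT; rewrite le_eqVlt => /predU1P[->|lt_mu].
    by rewrite /S (rootP (muP (ltn0Sn n)).1) mulr0.
  exact/ltW/(coherent_A_sign_lt (muP (ltn0Sn n)).2).
have := coherent_A_sign_lt (muP (ltn0Sn n.+1)).2 lt_mu.
rewrite -/(S _ _) S_rec {1}/S (rootP (muP (ltn0Sn n)).1) !mulr0 sub0r.
rewrite oppr_gt0 ltNge mulr_ge0// divr_ge0//.
  by rewrite mulr_ge0 ?sqr_ge0.
by rewrite !mulr_ge0 ?exprn_ge0 ?ler0n ?(ltW (k1_gt0 _)).
Qed.

(** Monotonicity of [mu] puts [z] below the zeros of every [A j] with [0 < j <= n], so that all
    pivots up to rank [n] are positive at once. *)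
Lemma coherent_A_sign_lt_smallest_zero z n j :
  (0 < n)%N -> z < mu n -> (j <= n)%N -> 0 < (-1) ^+ j * (A j).[z].
Proof.
move=> n0 zmu; elim: n n0 zmu j => // n IHn _ zmu j.
rewrite leq_eqVlt => /predU1P[->|].
  exact: coherent_A_sign_lt (muP (ltn0Sn n)).2 zmu.
case: n IHn zmu => [|n] IHn zmu; rewrite ltnS.
  by rewrite leqn0 => /eqP ->; rewrite -/(S z 0) S0.
by apply: IHn => //; apply: lt_le_trans zmu _; exact: smallest_zero_nonincreasing.
Qed.

End SmallestZero.

(* Completing squares along the recurrence: in the basis of the primitives of
   the [T_n], the ratios [- A_(n+1) / A_n] are the pivots of the form. *)
Lemma coherent_form_ge (z : R) n (p : {poly R}) :
  (forall j, (j <= n.+1)%N -> 0 < (-1) ^+ j * (A j).[z]) ->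
  (size p <= n.+2)%N -> c0 p = 0 ->
  ((-1) ^+ n.+1 * (A n.+1).[z]) / ((-1) ^+ n * (A n).[z])
    * k1 n * (n.+1%:R * p`_n.+1) ^+ 2
  <= c0 (p ^+ 2) - z * c1 (p^`() ^+ 2).
Proof.
have [Pm Ps Po] := opP; have [Tm Ts To] := opT.
have P0 : P 0%N = 1.
  have /size_poly1P[a a0 Pa] : size (P 0%N) == 1%N by rewrite Ps.
  by have := Pm 0%N; rewrite Pa monicE lead_coefC => /eqP ->.
have T0 : T 0%N = 1.
  have /size_poly1P[a a0 Ta] : size (T 0%N) == 1%N by rewrite Ts.
  by have := Tm 0%N; rewrite Ta monicE lead_coefC => /eqP ->.
have c0P k : c0 (P k.+1) = 0 by rewrite -(mul1r (P _)) -P0 Po.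
elim: n p => [|n IHn] p Sgt0 sp c0p.
  (* In degree at most one, [c0 p = 0] forces a multiple of [P 1], and the bound is then an
     equality. *)
  have pE : p = p`_1 *: P 1%N.
    have := size_sub_orthogonal_poly opP sp; move/size1_polyC => E.
    have : c0 (p - p`_1 *: P 1%N) = 0.
      by rewrite linearB linearZ /= c0p c0P mulr0 subrr.
    rewrite E -[_%:P]mulr1 mul_polyC linearZ /= => /eqP.
    rewrite mulf_eq0 => /orP[/eqP a0|].
      by apply/eqP; rewrite -subr_eq0 E a0.
    by have := k0_gt0 0; rewrite /k0 P0 expr1n => /gt_eqF ->.
  have P1' : (P 1%N)^`() = 1.
    have : (size (P 1%N)^`() <= 1)%N by rewrite -ltnS -(Ps 1%N) lt_size_deriv// monic_neq0.
    by move/size1_polyC ->; rewrite coef_deriv (orthogonal_polys_coef opP) mulr1n.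
  have -> : c0 (p ^+ 2) = p`_1 ^+ 2 * k0 1.
    by rewrite {1}pE exprZn linearZ.
  have -> : c1 (p^`() ^+ 2) = p`_1 ^+ 2 * k1 0.
    by rewrite {1}pE derivZ P1' exprZn linearZ /= /k1 T0.
  rewrite -/(S z 1) -/(S z 0) S1 S0 le_eqVlt.
  by apply/orP; left; apply/eqP; field; exact: lt0r_neq0 (k1_gt0 0).
pose s := sigma n.+1; pose N : R := n.+1%:R; pose N' : R := n.+2%:R.
have N0 : 0 < N by rewrite ltr0n.
have N'0 : 0 < N' by rewrite ltr0n.
(* The primitive of [T n.+1] given by coherence; its constant of integration is the one for which
   [c0 q = 0]. *)
pose q : {poly R} := N'^-1 *: P n.+2 - (s / N) *: P n.+1.
have q' : q^`() = T n.+1 by rewrite derivB !derivZ -coh.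
have sq : (size q <= n.+3)%N.
  rewrite (leq_trans (size_polyD _ _))// geq_max size_polyN.
  by rewrite !(leq_trans (size_scale_leq _ _)) ?Ps.
have qn : q`_n.+2 = N'^-1.
  rewrite coefB !coefZ (orthogonal_polys_coef opP) mulr1.
  by rewrite [X in _ * X]nth_default ?Ps// mulr0 subr0.
have c0q : c0 q = 0 by rewrite linearB /= !c0Z !c0P !mulr0 subrr.
(* [b] is the coefficient of degree [n.+1] in the derivative of [p]; as [T n.+1] is monic,
   subtracting [b *: q] lowers the degree of [p]. *)
pose b := N' * p`_n.+2; pose p0 := p - b *: q.
have sp0 : (size p0 <= n.+2)%N.
  apply/leq_sizeP => j; rewrite leq_eqVlt => /predU1P[<-|nj].
    by rewrite coefB coefZ qn /b mulrAC divff ?mul1r ?subrr// gt_eqF.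
  by rewrite coefB coefZ !nth_default ?mulr0 ?subrr// (leq_trans _ nj).
have c0p0 : c0 p0 = 0 by rewrite linearB linearZ /= c0p c0q mulr0 subrr.
have sp0' : (size p0^`() <= n.+1)%N.
  have [->|nz] := eqVneq p0 0; first by rewrite deriv0 size_poly0.
  by rewrite -ltnS (leq_trans (lt_size_deriv nz)).
(* Tridiagonality: the degree of [p0] makes it orthogonal to [P n.+2], so only the [P n.+1] part of
   [q] contributes. *)
have c0p0q : c0 (p0 * q) = - (s / N) * p0`_n.+1 * k0 n.+1.
  rewrite mulrBr linearB -!scalerAr /= !c0Z.
  rewrite (orthogonal_polys_size_le opP sp0) (orthogonal_polys_lead opP sp0).
  by rewrite -/(k0 _); ring.
have c0qq : c0 (q ^+ 2) = k0 n.+2 / N' ^+ 2 + s ^+ 2 / N ^+ 2 * k0 n.+1.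
  have P_ortho : c0 (N'^-1 *: P n.+2 * P n.+1) = 0.
    by rewrite -scalerAl c0Z Po ?mulr0// neq_ltn ltnSn orbT.
  rewrite /q -scaleNr scalar_sqrDZ P_ortho exprZn c0Z -/(k0 n.+1) -/(k0 n.+2).
  by field; rewrite !gt_eqF.
have c0pp : c0 (p ^+ 2) = c0 (p0 ^+ 2) + 2 * b * c0 (p0 * q) + b ^+ 2 * c0 (q ^+ 2).
  by rewrite -[in LHS](subrK (b *: q) p) -/p0 scalar_sqrDZ.
(* Diagonality: the derivative of [p0] has degree at most [n], hence is orthogonal to [T n.+1]. *)
have c1pp : c1 (p^`() ^+ 2) = c1 (p0^`() ^+ 2) + b ^+ 2 * k1 n.+1.
  rewrite -[in LHS](subrK (b *: q) p) -/p0 derivD derivZ q'.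
  by rewrite scalar_sqrDZ (orthogonal_polys_size_le opT sp0') mulr0 addr0.
have {IHn} := IHn p0 (fun j jn => Sgt0 j (leqW jn)) sp0 c0p0.
rewrite c0pp c1pp c0p0q c0qq -/(S z n) -/(S z n.+1) -/(S z n.+2) -/b S_rec.
rewrite -/s -/N -/N'.
have := Sgt0 n (ltnW (leqnSn _)); rewrite -/(S z n) => Sn.
have := Sgt0 n.+1 (leqnSn _); rewrite -/(S z n.+1) => Sn1.
have := k1_gt0 n; have := k1_gt0 n.+1.
move: (S z n) (S z n.+1) (k1 n) (k1 n.+1) (k0 n.+1) (k0 n.+2) p0`_n.+1 (c0 (p0 ^+ 2))
  (c1 (p0^`() ^+ 2)) Sn Sn1.
move=> u v K K1 L L1 y F G u0 v0 K10 K0 H.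
(* The pivot [v / u * K] from the induction hypothesis absorbs the cross term
   [- 2 * b * s * L * y / N] into a square; the extra [b ^+ 2] term this costs is the one subtracted
   in [S_rec]. *)
have sqr0 : 0 <= v / u * K * (N * y - s * L / N ^+ 2 * b * u / (v * K)) ^+ 2.
  by rewrite mulr_ge0 ?sqr_ge0// mulr_ge0// ?divr_ge0// ltW.
rewrite -subr_ge0 in H; rewrite -subr_ge0; apply: le_trans (addr_ge0 sqr0 H) _.
rewrite le_eqVlt; apply/orP; left; apply/eqP.
by field; rewrite !gt_eqF.
Qed.

Theorem smallest_zero_le_rayleigh (mu : nat -> R) n (p : {poly R}) :
  (forall n, (0 < n)%N -> is_smallest_zero (A n) (mu n)) ->
  (0 < n)%N -> (size p <= n.+1)%N ->
  mu n * c1 (p^`() ^+ 2) <= c0 (p ^+ 2).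
Proof.
move=> muP n0 sp.
have c01 : 0 < c0 1 by have := c0_gt0 (oner_neq0 {poly R}); rewrite expr1n.
(* Removing the mean keeps the derivative and can only decrease [c0 (p ^+ 2)]. *)
pose a := c0 p / c0 1; pose q := p - a%:P.
have c0q : c0 q = 0.
  rewrite linearB /= -[a%:P]mulr1 mul_polyC linearZ /= /a.
  by rewrite divfK ?subrr// gt_eqF.
have q' : q^`() = p^`() by rewrite derivB derivC subr0.
have sq : (size q <= n.+1)%N.
  rewrite (leq_trans (size_polyD _ _))// geq_max size_polyN sp.
  by rewrite (leq_trans (size_polyC_leq1 _)).
have c0qp : c0 (q ^+ 2) <= c0 (p ^+ 2).
  rewrite -[in leRHS](subrK a%:P p) -/q -[a%:P]mulr1 mul_polyC scalar_sqrDZ.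
  rewrite mulr1 c0q mulr0 addr0 lerDl expr1n.
  by rewrite mulr_ge0 ?sqr_ge0// ltW.
apply: le_trans c0qp; rewrite -q'.
have [->|nz] := eqVneq q^`() 0.
  rewrite expr0n /= linear0 mulr0.
  have [->|qz] := eqVneq q 0; first by rewrite expr0n /= linear0.
  exact/ltW/c0_gt0.
(* The pivots are quotients of values [S z j], so [z] is taken strictly below [mu n], at distance
   [e], and [e] tends to [0]. *)
rewrite -ler_pdivlMr ?c1_gt0//; apply/ler_addgt0Pl => e e0.
rewrite -lerBlDl ler_pdivlMr ?c1_gt0// -subr_ge0.
have zmu : mu n - e < mu n by rewrite ltrBlDr ltrDl.
case: n n0 sp sq zmu => // n n0 sp sq zmu.
have Sgt0 := coherent_A_sign_lt_smallest_zero muP n0 zmu.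
apply: le_trans (coherent_form_ge Sgt0 sq c0q).
by rewrite mulr_ge0 ?sqr_ge0// mulr_ge0 ?(ltW (k1_gt0 _))// divr_ge0// ltW// Sgt0.
Qed.

End CoherentPair.

(** * Integrals over an open interval *)

Section ImproperFTC.
Context {R : realType}.
Notation mu := (@lebesgue_measure R).
Implicit Types (f F : R -> R) (a b A B : R).

(** Monotone convergence for the positive and the negative part; integrability rules out a
    difference of infinities. *)
Lemma integrable_nondecreasing_set_cvg_integral d (T : measurableType d)
    (m : {measure set T -> \bar R}) (D : (set T)^nat) (f : T -> \bar R) :
  nondecreasing_seq D -> (forall i, measurable (D i)) ->
  m.-integrable (\bigcup_i D i) f ->
  (\int[m]_(x in D i) f x)%E @[i --> \oo] --> (\int[m]_(x in \bigcup_i D i) f x)%E.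
Proof.
move=> ndD mD fi.
have mU : measurable (\bigcup_i D i) by exact: bigcup_measurable.
have DU i : D i `<=` \bigcup_i D i by exact: bigcup_sup.
have mf := measurable_int _ fi.
rewrite [X in _ --> X]integralE; under eq_fun do rewrite integralE.
apply: cvgeB.
- exact: integrable_add_def.
- apply: ge0_nondecreasing_set_cvg_integral => // i.
  by apply: measurable_funS (DU i) _ => //; exact: measurable_funepos.
- apply: ge0_nondecreasing_set_cvg_integral => // i.
  by apply: measurable_funS (DU i) _ => //; exact: measurable_funeneg.
Qed.

(** Denominators from [3] on make every interval nondegenerate, the first one included. *)
Let itv_seq a b n : set R :=
  `[a + (b - a) / n.+3%:R, b - (b - a) / n.+3%:R]%classic.

Let itv_seq_lt a b n : a < b ->
  a < a + (b - a) / n.+3%:R /\ b - (b - a) / n.+3%:R < b /\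
  a + (b - a) / n.+3%:R < b - (b - a) / n.+3%:R.
Proof.
move=> ab; have ba : 0 < b - a by rewrite subr_gt0.
have h : 0 < (b - a) / n.+3%:R by rewrite divr_gt0.
have h3 : (b - a) / n.+3%:R <= (b - a) / 3%:R.
  by rewrite ler_pM2l// lef_pV2 ?posrE// ler_nat.
by move: (_ / n.+3%:R) h h3 => t ? ?; split; [lra|split; lra].
Qed.

Let itv_seq_nondecreasing a b : a < b -> nondecreasing_seq (itv_seq a b).
Proof.
move=> ab m n mn; rewrite subsetEset /itv_seq => x /=; rewrite !in_itv /=.
have h : (b - a) / n.+3%:R <= (b - a) / m.+3%:R.
  by rewrite ler_pM2l ?subr_gt0// lef_pV2 ?posrE// ler_nat.
move: (_ / n.+3%:R) (_ / m.+3%:R) h => t u ? /andP[? ?].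
by apply/andP; split; lra.
Qed.

Let cvg_step a b : (b - a) / n.+3%:R @[n --> \oo] --> (0 : R).
Proof.
rewrite -[X in _ --> X](mulr0 (b - a)); apply: cvgMr.
have := @cvg_harmonic R; rewrite -(cvg_shiftn 2).
by apply: cvg_trans; apply: near_eq_cvg; near=> n => /=; rewrite addn2.
Unshelve. all: by end_near. Qed.

Let itv_seq_bigcup a b : a < b -> \bigcup_n itv_seq a b n = `]a, b[%classic.
Proof.
move=> ab; rewrite /itv_seq; apply/seteqP; split => x /=.
  move=> [n _] /=; rewrite !in_itv /=.
  have := itv_seq_lt n ab; move: (_ / n.+3%:R) => t [? [? ?]] /andP[? ?].
  by apply/andP; split; lra.
rewrite in_itv /= => /andP[ax xb].
have e0 : 0 < Num.min (x - a) (b - x) by rewrite lt_min !subr_gt0 ax.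
have /cvgrPdist_lt /(_ _ e0) [n _ /(_ n (leqnn n))] := cvg_step a b.
rewrite sub0r normrN lt_min => /andP[].
rewrite ger0_norm ?divr_ge0 ?subr_ge0 ?(ltW ab)// => h1 h2.
exists n => //=; rewrite in_itv /=; move: (_ / n.+3%:R) h1 h2 => t ? ?.
by apply/andP; split; lra.
Qed.

(** Common core of the two lemmas below: on a compact subinterval the fundamental theorem involves
    only interior values of [F], which tend to its one-sided limits. *)
Let cvg_integral_itv_seq f F a b A B : a < b ->
  {in `]a, b[, continuous f} ->
  (forall x, x \in `]a, b[ -> is_derive x 1 F (f x)) ->
  F x @[x --> a^'+] --> A -> F x @[x --> b^'-] --> B ->
  (\int[mu]_(x in itv_seq a b n) (f x)%:E)%E @[n --> \oo] --> (B - A)%:E.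
Proof.
move=> ab cf dF FA FB.
have cF x : x \in `]a, b[ -> {for x, continuous F}.
  move=> /dF ?; apply/differentiable_continuous/derivable1_diffP.
  exact: ex_derive.
have sub n x : itv_seq a b n x -> x \in `]a, b[.
  suff + : itv_seq a b n `<=` `]a, b[ by apply.
  by rewrite -(itv_seq_bigcup ab); exact: bigcup_sup.
have intE n : (\int[mu]_(x in itv_seq a b n) (f x)%:E)%E =
    (F (b - (b - a) / n.+3%:R) - F (a + (b - a) / n.+3%:R))%:E.
  have := itv_seq_lt n ab; have := @sub n; rewrite /itv_seq.
  move: (_ / n.+3%:R) => t {}sub [? [? lt]].
  rewrite (@continuous_FTC2 _ f F _ _ lt) ?EFinB//.
  - by apply: continuous_in_subspaceT => x /set_mem /sub xab; exact: cf.
  - split.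
    + move=> x xab; apply: ex_derive; apply: dF; move: xab; rewrite !in_itv /=.
      by move=> /andP[? ?]; apply/andP; split; lra.
    + by apply: cvg_at_right_filter; apply: cF; rewrite in_itv /=; apply/andP; split; lra.
    + by apply: cvg_at_left_filter; apply: cF; rewrite in_itv /=; apply/andP; split; lra.
  - move=> x xab; have : is_derive x 1 F (f x).
      apply: dF; move: xab; rewrite !in_itv /=.
      by move=> /andP[? ?]; apply/andP; split; lra.
    by move=> ?; rewrite derive1E derive_val.
under eq_fun do rewrite intE.
apply: cvg_EFin; first exact: nearW.
apply: cvgB.
- apply: (cvg_comp _ _ _ FB) => U [e /= e0 eU].
  have /cvgrPdist_lt /(_ _ e0) := cvg_step a b.
  apply: filterS => n /= hn; apply: eU => /=; last first.
    by have [? [? ?]] := itv_seq_lt n ab.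
  by rewrite opprB addrC subrK; move: hn; rewrite sub0r normrN.
- apply: (cvg_comp _ _ _ FA) => U [e /= e0 eU].
  have /cvgrPdist_lt /(_ _ e0) := cvg_step a b.
  apply: filterS => n /= hn; apply: eU => /=; last first.
    by have [? [? ?]] := itv_seq_lt n ab.
  by rewrite opprD addNKr; move: hn; rewrite sub0r.
Qed.

(** Integrability turns the limit over compact subintervals into the integral over the open
    interval, whatever the sign of [f]. *)
Lemma integrable_FTC2_oo f F a b A B : a < b ->
  {in `]a, b[, continuous f} -> mu.-integrable `]a, b[ (EFin \o f) ->
  (forall x, x \in `]a, b[ -> is_derive x 1 F (f x)) ->
  F x @[x --> a^'+] --> A -> F x @[x --> b^'-] --> B ->
  \int[mu]_(x in `]a, b[) f x = B - A.
Proof.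
move=> ab cf fi dF FA FB; rewrite /Rintegral.
suff -> : (\int[mu]_(x in `]a, b[) (f x)%:E)%E = (B - A)%:E by [].
have h := cvg_integral_itv_seq ab cf dF FA FB.
apply/esym; apply: (cvg_unique _ h) => //.
rewrite -(itv_seq_bigcup ab); apply: integrable_nondecreasing_set_cvg_integral => //.
- exact: itv_seq_nondecreasing.
- by move=> i; exact: measurable_itv.
- by rewrite (itv_seq_bigcup ab).
Qed.

(** For nonnegative [f], monotone convergence identifies the integral of its absolute value with the
    finite number [B - A]. *)
Lemma ge0_integrable_FTC2_oo f F a b A B : a < b ->
  {in `]a, b[, continuous f} -> (forall x, x \in `]a, b[ -> 0 <= f x) ->
  (forall x, x \in `]a, b[ -> is_derive x 1 F (f x)) ->
  F x @[x --> a^'+] --> A -> F x @[x --> b^'-] --> B ->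
  mu.-integrable `]a, b[ (EFin \o f).
Proof.
move=> ab cf f0 dF FA FB.
have mf : measurable_fun `]a, b[ f.
  by apply: open_continuous_measurable_fun => // x /set_mem; exact: cf.
apply/integrableP; split; first exact/measurable_EFinP.
rewrite (_ : (\int[mu]_(x in _) _)%E = (B - A)%:E) ?ltry//.
have h := cvg_integral_itv_seq ab cf dF FA FB.
apply/esym; apply: (cvg_unique _ h) => //.
under eq_integral => x /set_mem xab do rewrite gee0_abs ?lee_fin ?f0//.
rewrite -(itv_seq_bigcup ab); apply: ge0_nondecreasing_set_cvg_integral.
- exact: itv_seq_nondecreasing.
- by move=> i; exact: measurable_itv.
- move=> i; apply/measurable_EFinP; apply: measurable_funS mf => //.
  by rewrite -(itv_seq_bigcup ab); exact: bigcup_sup.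
- move=> i x xi; rewrite lee_fin f0//.
  have : `]a, b[%classic x by rewrite -(itv_seq_bigcup ab); exists i.
  by [].
Qed.

End ImproperFTC.

(** * Jacobi weights *)

Section JacobiWeight.
Context {R : realType}.
Notation mu := (@lebesgue_measure R).
Implicit Types a b x : R.

Lemma is_derive_powR1D b x : -1 < x ->
  is_derive x 1 (fun y => (1 + y) `^ b) (b * (1 + x) `^ (b - 1)).
Proof.
move=> x1; have x0 : 0 < 1 + x by lra.
have D : is_derive x 1 (fun y : R => 1 + y) 1 by apply: is_derive_eq; rewrite add0r mulr1.
have := @is_derive1_comp _ _ (fun y => 1 + y) x _ _ (is_derive1_powR b x0) D.
by move=> h; apply: (is_derive_eq h); rewrite mulr1.
Qed.

Lemma is_derive_powR1B a x : x < 1 ->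
  is_derive x 1 (fun y => (1 - y) `^ a) (- (a * (1 - x) `^ (a - 1))).
Proof.
move=> x1; have x0 : 0 < 1 - x by lra.
have D : is_derive x 1 (fun y : R => 1 - y) (-1) by apply: is_derive_eq; rewrite add0r mul1r.
have := @is_derive1_comp _ _ (fun y => 1 - y) x _ _ (is_derive1_powR a x0) D.
by move=> h; apply: (is_derive_eq h); rewrite mulrN1.
Qed.

Lemma continuous_powR1D b x : -1 < x -> {for x, continuous (fun y : R => (1 + y) `^ b)}.
Proof.
move=> /(is_derive_powR1D b) ?; apply/differentiable_continuous/derivable1_diffP.
exact: ex_derive.
Qed.

Lemma continuous_powR1B a x : x < 1 -> {for x, continuous (fun y : R => (1 - y) `^ a)}.
Proof.
move=> /(is_derive_powR1B a) ?; apply/differentiable_continuous/derivable1_diffP.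
exact: ex_derive.
Qed.

Lemma cvg_powR1D_N1 b : 0 < b -> (1 + x) `^ b @[x --> (-1)^'+] --> (0 : R).
Proof.
move=> b0; apply: (@cvg_comp _ _ _ (fun x => 1 + x) (@powR R ^~ b) _ (0 : R)^'+).
  move=> U [e /= e0 eU]; exists e => //= x /= xe x1; apply: eU => /=; last by lra.
  by move: xe; rewrite sub0r normrN -opprD normrN.
exact: powR_cvg0.
Qed.

Lemma cvg_powR1B_1 a : 0 < a -> (1 - x) `^ a @[x --> 1^'-] --> (0 : R).
Proof.
move=> a0; apply: (@cvg_comp _ _ _ (fun x => 1 - x) (@powR R ^~ a) _ (0 : R)^'+).
  move=> U [e /= e0 eU]; exists e => //= x /= xe x1; apply: eU => /=; last by lra.
  by move: xe; rewrite sub0r normrN.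
exact: powR_cvg0.
Qed.

Lemma cvg_powR1D_1 b : (1 + x) `^ b @[x --> 1^'-] --> (2 `^ b : R).
Proof.
apply: cvg_at_left_filter; rewrite [2]/(1 + 1); apply: continuous_powR1D; lra.
Qed.

Lemma cvg_powR1B_N1 a : (1 - x) `^ a @[x --> (-1)^'+] --> (2 `^ a : R).
Proof.
apply: cvg_at_right_filter.
have -> : 2 = 1 - (-1) :> R by lra.
by apply: continuous_powR1B; lra.
Qed.

Lemma measurable_jacobi_weight a b (D : set R) :
  measurable_fun D (fun x => (1 - x) `^ a * (1 + x) `^ b).
Proof.
apply: measurable_funTS; apply: measurable_funM.
  by apply: (@measurableT_comp _ _ _ _ _ _ (@powR R ^~ a) _ (fun x => 1 - x)) => //; exact: measurable_funB.
by apply: (@measurableT_comp _ _ _ _ _ _ (@powR R ^~ b) _ (fun x => 1 + x)) => //; exact: measurable_funD.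
Qed.

(** Controls a factor of the weight on the half of the interval away from its own endpoint, for
    exponents of either sign. *)
Lemma powR_le_2_norm x c : 1 <= x -> x <= 2 -> x `^ c <= 2 `^ `|c|.
Proof.
move=> x1 x2; apply: (@le_trans _ _ (x `^ `|c|)).
  by rewrite ler_powR// ler_norm.
by rewrite ge0_ler_powR// nnegrE; lra.
Qed.

(** On each half of the interval one factor is bounded, so a multiple of the sum [f] of the two
    factors dominates their product. The primitive [F] of [f] has finite limits because [a + 1] and
    [b + 1] are positive. *)
Lemma integrable_jacobi_weight a b : -1 < a -> -1 < b ->
  mu.-integrable `]-1, 1[ (EFin \o (fun x => (1 - x) `^ a * (1 + x) `^ b)).
Proof.
move=> a1 b1; have a0 : 0 < a + 1 by lra. have b0 : 0 < b + 1 by lra.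
pose f x : R := (1 + x) `^ b + (1 - x) `^ a.
pose F x : R := (b + 1)^-1 * (1 + x) `^ (b + 1) - (a + 1)^-1 * (1 - x) `^ (a + 1).
have fi : mu.-integrable `]-1, 1[ (EFin \o f).
  apply: (@ge0_integrable_FTC2_oo _ f F (-1) 1
    ((b + 1)^-1 * 0 - (a + 1)^-1 * 2 `^ (a + 1))
    ((b + 1)^-1 * 2 `^ (b + 1) - (a + 1)^-1 * 0)).
  - lra.
  - move=> x; rewrite in_itv /= => /andP[x1 x2].
    by apply: cvgD; [exact: continuous_powR1D|exact: continuous_powR1B].
  - by move=> x _; rewrite addr_ge0// powR_ge0.
  - move=> x; rewrite in_itv /= => /andP[x1 x2].
    have ? := is_derive_powR1D (b + 1) x1; have ? := is_derive_powR1B (a + 1) x2.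
    apply: is_derive_eq; rewrite /GRing.scale /= !addrK mulrN opprK.
    by rewrite !mulrA !mulVf ?mul1r// gt_eqF.
  - by apply: cvgB; apply: cvgMr; [exact: cvg_powR1D_N1|exact: cvg_powR1B_N1].
  - by apply: cvgB; apply: cvgMr; [exact: cvg_powR1D_1|exact: cvg_powR1B_1].
pose C : R := 2 `^ `|a| + 2 `^ `|b|.
have C0 : 0 <= C by rewrite addr_ge0// powR_ge0.
apply: le_integrable (integrableZl _ C fi) => //.
  by apply/measurable_EFinP; exact: measurable_jacobi_weight.
move=> x /=; rewrite in_itv /= => /andP[x1 x2].
rewrite lee_fin ger0_norm ?mulr_ge0 ?powR_ge0//.
rewrite ger0_norm ?mulr_ge0 ?addr_ge0 ?powR_ge0// /C /f.
have bound (u v A B : R) : 0 <= u -> 0 <= v -> 0 <= A -> 0 <= B ->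
    u <= B \/ v <= A -> v * u <= (A + B) * (u + v).
  move=> u0 v0 A0 B0 uv.
  have := mulr_ge0 A0 u0; have := mulr_ge0 A0 v0.
  have := mulr_ge0 B0 u0; have := mulr_ge0 B0 v0.
  by case: uv => [/(ler_wpM2l v0)|/(ler_wpM2l u0)]; lra.
apply: bound; rewrite ?powR_ge0//.
by have [x0|x0] := leP 0 x; [left|right]; apply: powR_le_2_norm; lra.
Qed.

(** Integration by parts: the difference of the two sides integrates the derivative of [(1 - x)]^ (a
    + 1) * (1 + x) [^ b], which vanishes at both ends. *)
Lemma integral_jacobi_weight_shift a b : -1 < a -> 0 < b ->
  b * \int[mu]_(x in `]-1, 1[) ((1 - x) `^ (a + 1) * (1 + x) `^ (b - 1)) =
  (a + 1) * \int[mu]_(x in `]-1, 1[) ((1 - x) `^ a * (1 + x) `^ b).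
Proof.
move=> a1 b0; have a0 : 0 < a + 1 by lra.
have i1 : mu.-integrable `]-1, 1[
    (EFin \o (fun x => (1 - x) `^ (a + 1) * (1 + x) `^ (b - 1))).
  by apply: integrable_jacobi_weight; lra.
have i2 : mu.-integrable `]-1, 1[ (EFin \o (fun x => (1 - x) `^ a * (1 + x) `^ b)).
  by apply: integrable_jacobi_weight; lra.
have mI : measurable (`]-1, 1[%classic : set (g_sigma_algebraType R.-ocitv.-measurable)).
  exact: measurable_itv.
have j1 := integrableZl mI b i1; have j2 := integrableZl mI (a + 1) i2.
rewrite -!RintegralZl//; apply/eqP; rewrite -subr_eq0 -RintegralB//; apply/eqP.
(* The zero is spelled as the difference of the limits at [1] and at [-1], each a product of limits
   of the factors. *)
transitivity (0 * 2 `^ b - 2 `^ (a + 1) * 0 : R); last by rewrite mul0r mulr0 subrr.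
apply: (@integrable_FTC2_oo _ _ (fun x => (1 - x) `^ (a + 1) * (1 + x) `^ b) (-1) 1).
- lra.
- move=> x; rewrite in_itv /= => /andP[x1 x2].
  by apply: cvgB; apply: cvgMr;
    (apply: cvgM; [exact: continuous_powR1B|exact: continuous_powR1D]).
- exact: (integrableB mI j1 j2).
- move=> x; rewrite in_itv /= => /andP[x1 x2].
  have ? := is_derive_powR1D b x1; have ? := is_derive_powR1B (a + 1) x2.
  by apply: is_derive_eq; rewrite /GRing.scale /= addrK; ring.
- by apply: cvgM; [exact: cvg_powR1B_N1|exact: cvg_powR1D_N1].
- by apply: cvgM; [exact: cvg_powR1B_1|exact: cvg_powR1D_1].
Qed.

End JacobiWeight.

(** * Functionals given by a positive integrable weight *)

Lemma finite_set_root (F : idomainType) (p : {poly F}) :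
  p != 0 -> finite_set [set x | root p x].
Proof.
move=> p0; apply: contrapT => /(@infinite_set_fset _ _ (size p)) [B Bp].
rewrite leqNgt => /negP; apply.
apply: max_poly_roots p0 _ (finmap.fset_uniq B).
by apply/allP => x xB; exact: Bp.
Qed.

Section WeightedFunctional.
Context {R : realType} (w : R -> R).
Notation mu := (@lebesgue_measure R).
Hypothesis w_gt0 : forall x, x \in `]-1, 1[ -> 0 < w x.
Hypothesis wi : mu.-integrable `]-1, 1[ (EFin \o w).

Let mI : measurable (`]-1, 1[%classic : set (g_sigma_algebraType R.-ocitv.-measurable)).
Proof. exact: measurable_itv. Qed.

Lemma integrable_poly_weight (p : {poly R}) :
  mu.-integrable `]-1, 1[ (EFin \o (fun x => p.[x] * w x)).
Proof.
apply: (integrableMr mI _ _ wi); first exact: measurable_poly.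
(* Every monomial is at most [1] in absolute value on the interval. *)
exists (\sum_(i < size p) `|p`_i|); split; first exact: num_real.
move=> M ltM x; rewrite /= in_itv /= => /andP[x1 x2].
apply: le_trans (ltW ltM); rewrite horner_coef; apply: le_trans (ler_norm_sum _ _ _) _.
apply: ler_sum => i _; rewrite normrM ler_piMr// normrX exprn_ile1//.
by rewrite ler_norml; apply/andP; split; lra.
Qed.

Lemma scalar_poly_weight : scalar (fun p : {poly R} =>
  \int[mu]_(x in `]-1, 1[) (p.[x] * w x)).
Proof.
move=> a p q /=; have pi := integrable_poly_weight p.
have qi := integrable_poly_weight q; have api := integrableZl mI a pi.
rewrite -RintegralZl// -RintegralD//.
by apply: eq_Rintegral => x _; rewrite hornerD hornerZ mulrDl mulrA.
Qed.

Lemma poly_weight_sqr_ge0 (p : {poly R}) :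
  0 <= \int[mu]_(x in `]-1, 1[) ((p ^+ 2).[x] * w x).
Proof.
apply: Rintegral_ge0 => x xI.
by rewrite mulr_ge0 ?(ltW (w_gt0 xI))// hornerE sqr_ge0.
Qed.

(** Were the integral zero, the integrand would vanish almost everywhere; the interval, of length
    [2], would be covered by a null set and the finitely many zeros of [p]. *)
Lemma poly_weight_sqr_gt0 (p : {poly R}) : p != 0 ->
  0 < \int[mu]_(x in `]-1, 1[) ((p ^+ 2).[x] * w x).
Proof.
move=> p0; rewrite lt_neqAle poly_weight_sqr_ge0 andbT eq_sym; apply/negP => /eqP int0.
pose f x := (p ^+ 2).[x] * w x.
have fi : mu.-integrable `]-1, 1[ (EFin \o f) by exact: integrable_poly_weight.
have f0 x : x \in `]-1, 1[ -> 0 <= f x.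
  by move=> xI; rewrite mulr_ge0 ?(ltW (w_gt0 xI))// hornerE sqr_ge0.
have : (\int[mu]_(x in `](-1)%R, 1%R[) `|(f x)%:E|)%E = 0%E.
  under eq_integral => x /set_mem xI do rewrite gee0_abs ?lee_fin ?f0//.
  by rewrite -[RHS]/(0%R%:E) -int0 /Rintegral fineK//; exact: integrable_fin_num.
move/(ae_eq_integral_abs mu mI (measurable_int _ fi)) => [N [mN N0 subN]].
pose Z : set (g_sigma_algebraType R.-ocitv.-measurable) := [set x | root p x].
have cZ : countable Z by apply: finite_set_countable; exact: finite_set_root.
have mZ : measurable Z by apply: countable_measurable => // t; exact: measurable_set1.
have Z0 : mu Z = 0%E by exact: countable_lebesgue_measure0.
pose I : set (g_sigma_algebraType R.-ocitv.-measurable) := `]-1, 1[%classic.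
have : (mu I <= mu (N `|` Z))%E.
  apply: le_measure; rewrite ?inE//.
    exact: measurableU.
  move=> x xI; have [px|px] := boolP (root p x); first by right.
  left; apply: subN => /=; apply/not_implyP; split => //.
  move=> [] /eqP; rewrite /f mulf_eq0 hornerE sqrf_eq0 (negbTE (px : p.[x] != 0)) /=.
  by rewrite gt_eqF// w_gt0.
rewrite measureU0// N0 lebesgue_measure_itv /= lte_fin.
by rewrite (_ : -1 < 1 = true) ?lee_fin; lra.
Qed.

End WeightedFunctional.

(** * The Jacobi functionals [c0] and [c1] *)

Section JacobiFunctionals.
Context {R : realType} (alpha beta xi M : R).
Notation mu := (@lebesgue_measure R).
Hypothesis alpha_gt : -1 < alpha.
Hypothesis beta_gt : -1 < beta.
Hypothesis xi_ge1 : 1 <= `|xi|.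
Hypothesis M_ge0 : 0 <= M.
Let c0 : {poly R} -> R := jacobi_functional alpha beta.
Let c1 : {poly R} -> R := jacobi_dirac_functional alpha beta xi M.
Let w0 (x : R) := (1 - x) `^ alpha * (1 + x) `^ beta.
Let w1 (x : R) := (1 - x) `^ (alpha + 1) * (1 + x) `^ (beta + 1) / `|x - xi|.

Let jacobi_weight_gt0 a b x :
  x \in `]-1, 1[ -> 0 < (1 - x) `^ a * (1 + x) `^ b :> R.
Proof.
rewrite in_itv /= => /andP[x1 x2].
by rewrite mulr_gt0// powR_gt0; lra.
Qed.

(** The lower bound, from [|xi| >= 1], keeps the weight of [c1] integrable even for [xi] at an
    endpoint; the upper one serves to bound [c1] from below. *)
Let dist_xi_bounds x : x \in `]-1, 1[ -> 1 - `|x| <= `|x - xi| <= 1 + `|xi|.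
Proof.
rewrite in_itv /= => /andP[x1 x2]; have x_le1 : `|x| <= 1.
  by rewrite ler_norml; apply/andP; split; lra.
apply/andP; split.
  by rewrite distrC (le_trans _ (lerB_dist _ _))// lerB.
by rewrite (le_trans (ler_normB _ _))// lerD.
Qed.

Let dist_xi_gt0 x : x \in `]-1, 1[ -> 0 < `|x - xi|.
Proof.
move=> xI; have /andP[+ _] := dist_xi_bounds xI; apply: lt_le_trans.
by move: xI; rewrite in_itv /= subr_gt0 ltr_norml.
Qed.

Let w1_gt0 x : x \in `]-1, 1[ -> 0 < w1 x.
Proof. by move=> xI; rewrite /w1 divr_gt0 ?jacobi_weight_gt0 ?dist_xi_gt0. Qed.

Let w0i : mu.-integrable `]-1, 1[ (EFin \o w0).
Proof. exact: integrable_jacobi_weight. Qed.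

Let powR_succ (y a : R) : 0 < y -> y `^ (a + 1) = y * y `^ a.
Proof.
move=> y0; rewrite powRD ?powRr1 ?ltW// 1?mulrC//.
by rewrite (gt_eqF y0) implybT.
Qed.

(* [(1 - x) (1 + x) = (1 - |x|) (1 + |x|)] and [1 - |x| <= |x - xi|]. *)
Let w1_le x : x \in `]-1, 1[ -> w1 x <= 2 * w0 x.
Proof.
move=> xI; have /andP[d1 _] := dist_xi_bounds xI.
rewrite /w1 ler_pdivrMr ?dist_xi_gt0// /w0.
have [x1 x2] : -1 < x /\ x < 1 by move: xI; rewrite in_itv /= => /andP[].
rewrite !powR_succ; [|lra..].
have : (1 - x) * (1 + x) <= 2 * `|x - xi|.
  have : (1 - x) * (1 + x) <= 2 * (1 - `|x|) by have [|] := ger0P x; nra.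
  lra.
have := ltW (jacobi_weight_gt0 alpha beta xI) => /ler_wpM2l /[apply].
by move: (_ `^ _) (_ `^ _) => u v; lra.
Qed.

Let w1i : mu.-integrable `]-1, 1[ (EFin \o w1).
Proof.
have mI : measurable (`]-1, 1[%classic : set (g_sigma_algebraType R.-ocitv.-measurable)).
  exact: measurable_itv.
apply: (le_integrable mI _ _ (integrableZl mI 2 w0i)).
  apply/measurable_EFinP; apply: measurable_funM; first exact: measurable_jacobi_weight.
  apply: open_continuous_measurable_fun => // x /set_mem xI.
  apply: cvgV; first by rewrite gt_eqF ?dist_xi_gt0.
  by apply: cvg_norm; apply: cvgB; [exact: cvg_id|exact: cvg_cst].
move=> x xI /=; rewrite lee_fin ger0_norm; last exact/ltW/w1_gt0.
exact: le_trans (w1_le xI) (ler_norm _).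
Qed.

Lemma jacobi_functional_scalar : scalar c0.
Proof. exact: scalar_poly_weight w0i. Qed.

Lemma jacobi_functional_sqr_gt0 p : p != 0 -> 0 < c0 (p ^+ 2).
Proof. by apply: poly_weight_sqr_gt0 w0i _ => x; exact: jacobi_weight_gt0. Qed.

Lemma jacobi_dirac_functional_scalar : scalar c1.
Proof.
move=> a p q; rewrite /c1 /jacobi_dirac_functional.
have -> := scalar_poly_weight w1i a p q.
by rewrite hornerD hornerZ /= /GRing.scale /= /w1; ring.
Qed.

Lemma jacobi_dirac_functional_sqr_gt0 p : p != 0 -> 0 < c1 (p ^+ 2).
Proof.
move=> p0; rewrite ltr_pwDl//; first exact: (poly_weight_sqr_gt0 w1_gt0 w1i).
by rewrite hornerE mulr_ge0// sqr_ge0.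
Qed.

(** The Dirac term is nonnegative on squares, and [|x - xi| <= 1 + |xi|]. *)
Lemma jacobi_dirac_functional_sqr_ge p :
  jacobi_functional (alpha + 1) (beta + 1) (p ^+ 2) / (1 + `|xi|) <= c1 (p ^+ 2).
Proof.
have mI : measurable (`]-1, 1[%classic : set (g_sigma_algebraType R.-ocitv.-measurable)).
  exact: measurable_itv.
apply: (@le_trans _ _ (\int[mu]_(x in `]-1, 1[) ((p ^+ 2).[x] * w1 x))); last first.
  by rewrite lerDl mulr_ge0// hornerE sqr_ge0.
have xi0 : 0 < 1 + `|xi| by rewrite ltr_pwDl.
have ji : mu.-integrable `]-1, 1[ (EFin \o (fun x : R =>
    (p ^+ 2).[x] * ((1 - x) `^ (alpha + 1) * (1 + x) `^ (beta + 1)))).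
  by apply: integrable_poly_weight; apply: integrable_jacobi_weight; rewrite ltr_wpDr.
have pi := @integrable_poly_weight _ _ w1i (p ^+ 2).
rewrite mulrC -RintegralZl//; apply: le_Rintegral => //.
  exact: (integrableZl mI _ ji).
move=> x xI; rewrite mulrC -mulrA; apply: ler_wpM2l; first by rewrite hornerE sqr_ge0.
apply: ler_wpM2l; first exact/ltW/jacobi_weight_gt0.
rewrite lef_pV2 ?posrE ?dist_xi_gt0//.
by have /andP[] := dist_xi_bounds xI.
Qed.

(* These powers concentrate at the endpoint 1, where the weight of [c_1] loses
   only one factor [1 - x] against the gain [n^2]: the quotient grows like [n]. *)
Lemma jacobi_rayleigh_pow n (p : {poly R} := (1 + 'X) ^+ n) : (0 < n)%N ->
  n%:R ^+ 2 * (alpha + 1) / ((1 + `|xi|) * (beta + n.*2%:R)) * c0 (p ^+ 2)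
    <= c1 (p^`() ^+ 2).
Proof.
case: n @p => // n; set N := n.+1; move=> p _.
have N1 : 1 <= N%:R :> R by rewrite ler1n.
have N2 : N.*2%:R = N%:R + N%:R :> R by rewrite -addnn natrD.
have b0 : 0 < beta + N.*2%:R by rewrite N2; have := beta_gt; lra.
have xi0 : 0 < 1 + `|xi| by rewrite ltr_pwDl.
have powX (x b : R) k : -1 < x -> (1 + x) ^+ k * (1 + x) `^ b = (1 + x) `^ (b + k%:R).
  move=> x1; have x0 : 0 < 1 + x by lra.
  by rewrite powRD ?(gt_eqF x0) ?implybT// powR_mulrn ?ltW// mulrC.
have p2 x : (p ^+ 2).[x] = (1 + x) ^+ N.*2.
  by rewrite /p -exprM muln2 !hornerE.
have p'E : p^`() = (N%:R : R) *: (1 + 'X) ^+ n.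
  by rewrite /p deriv_exp derivD derivC derivX add0r mul1r scaler_nat.
have p'2 x : (p^`() ^+ 2).[x] = N%:R ^+ 2 * (1 + x) ^+ n.*2.
  by rewrite p'E exprZn -exprM muln2 !hornerE.
have c0E : c0 (p ^+ 2) =
    \int[mu]_(x in `]-1, 1[) ((1 - x) `^ alpha * (1 + x) `^ (beta + N.*2%:R)).
  apply: eq_Rintegral => x /set_mem; rewrite /= in_itv /= => /andP[x1 x2].
  by rewrite p2 -powX// mulrCA mulrA.
have j1i : mu.-integrable `]-1, 1[ (EFin \o (fun x : R =>
    (1 - x) `^ (alpha + 1) * (1 + x) `^ (beta + N.*2%:R - 1))).
  by apply: integrable_jacobi_weight; rewrite ?N2; have := alpha_gt; have := beta_gt; lra.
have c1E : jacobi_functional (alpha + 1) (beta + 1) (p^`() ^+ 2) = N%:R ^+ 2 *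
    \int[mu]_(x in `]-1, 1[) ((1 - x) `^ (alpha + 1) * (1 + x) `^ (beta + N.*2%:R - 1)).
  rewrite -RintegralZl//; apply: eq_Rintegral => x /set_mem.
  rewrite /= in_itv /= => /andP[x1 x2]; rewrite p'2.
  (* Differentiation costs two factors [1 + x] in the square and the weight of [c1] returns one,
     hence the exponent [beta + 2 N - 1]. *)
  have -> : beta + N.*2%:R - 1 = (beta + 1) + n.*2%:R.
    by rewrite /N doubleS -!natr1; lra.
  by rewrite -powX//; ring.
apply: le_trans (jacobi_dirac_functional_sqr_ge _).
rewrite c1E c0E.
(* With [a = alpha] and [b = beta + 2 N] the two integrals are tied exactly, so an equality
   remains. *)
have := integral_jacobi_weight_shift alpha_gt b0.
move: (\int[mu]_(x in _) _) (\int[mu]_(x in _) _) => J0 J1 shift.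
have -> : J1 = (alpha + 1) * J0 / (beta + N.*2%:R).
  by rewrite -shift mulrAC divff ?mul1r// gt_eqF.
rewrite le_eqVlt; apply/orP; left; apply/eqP.
by field; rewrite !gt_eqF.
Qed.

End JacobiFunctionals.

(** * The limit of the smallest zeros *)

Unset Implicit Arguments.

Theorem mainTheorem18 (R : realType) (alpha beta xi M : R)
    (P T : nat -> {poly R}) (sigma mu1 : nat -> R)
    (c0 := jacobi_functional alpha beta)
    (c1 := jacobi_dirac_functional alpha beta xi M)
    (k0 := fun n => c0 (P n ^+ 2))
    (k1 := fun n => c1 (T n ^+ 2)) :
  -1 < alpha -> -1 < beta -> 1 <= `|xi| -> 0 <= M ->
  monic_orthogonal_polys c0 P ->
  monic_orthogonal_polys c1 T ->
  coherence_relation P T sigma ->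
  (forall n, (0 < n)%N -> is_smallest_zero (coherent_A k0 k1 sigma n) (mu1 n)) ->
  mu1 n @[n --> \oo] --> (0 : R).
Proof.
move=> alpha_gt beta_gt xi_ge1 M_ge0 opP opT coh muP.
pose L0 : {scalar {poly R}} := HB.pack c0
  (GRing.isLinear.Build _ _ _ _ c0 (jacobi_functional_scalar alpha_gt beta_gt)).
pose L1 : {scalar {poly R}} := HB.pack c1
  (GRing.isLinear.Build _ _ _ _ c1
     (jacobi_dirac_functional_scalar M alpha_gt beta_gt xi_ge1)).
have c0_gt0 : forall p : {poly R}, p != 0 -> 0 < L0 (p ^+ 2).
  exact: jacobi_functional_sqr_gt0.
have c1_gt0 : forall p : {poly R}, p != 0 -> 0 < L1 (p ^+ 2).
  exact: jacobi_dirac_functional_sqr_gt0.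
(* For [N >= 1], [beta + 2 N <= (|beta| + 2) N], so the Rayleigh bound is at most [C / N]. *)
pose C := (1 + `|xi|) * (`|beta| + 2) / (alpha + 1).
have a0 : 0 < alpha + 1 by rewrite -ltrBlDr sub0r.
have xi0 : 0 < 1 + `|xi| by rewrite ltr_pwDl.
(* Indices start at [1]: [A 0] has no zero and the value [mu1 0] is arbitrary. *)
have mu_ge0 n : 0 <= mu1 n.+1.
  apply/ltW/(@coherent_A_root_gt0 _ L0 L1 c0_gt0 c1_gt0 P T sigma opP opT _ n.+1).
  exact: (muP n.+1 isT).1.
have mu_le n : mu1 n.+1 <= C * n.+1%:R^-1.
  pose p : {poly R} := (1 + 'X) ^+ n.+1.
  have N0 : 0 < n.+1%:R :> R by rewrite ltr0n.
  have sp : size p = n.+2.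
    have -> : p = ('X - (-1)%:P) ^+ n.+1 by rewrite /p polyCN polyC1 opprK addrC.
    exact: size_exp_XsubC.
  have p0 : p != 0 by rewrite -size_poly_eq0 sp.
  have rayleigh : mu1 n.+1 * c1 (p^`() ^+ 2) <= c0 (p ^+ 2).
    exact: (@smallest_zero_le_rayleigh _ L0 L1 c0_gt0 c1_gt0 P T sigma opP opT coh
      mu1 n.+1 p muP isT (eq_leq sp)).
  have pow : n.+1%:R ^+ 2 * (alpha + 1) / ((1 + `|xi|) * (beta + n.+1.*2%:R))
      * c0 (p ^+ 2) <= c1 (p^`() ^+ 2).
    exact: jacobi_rayleigh_pow.
  have J0 : 0 < c0 (p ^+ 2) by exact: c0_gt0.
  have N1 : 1 <= n.+1%:R :> R by rewrite ler1n.
  have N2 : n.+1.*2%:R = n.+1%:R + n.+1%:R :> R by rewrite -addnn natrD.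
  have b0 : 0 < beta + n.+1.*2%:R by rewrite N2; lra.
  have := le_trans (ler_wpM2l (mu_ge0 n) pow) rayleigh.
  rewrite mulrA -[leRHS]mul1r ler_pM2r// mulrA ler_pdivrMr ?mulr_gt0// mul1r => h.
  have {h} : mu1 n.+1 * (n.+1%:R ^+ 2 * (alpha + 1)) <=
      (1 + `|xi|) * ((`|beta| + 2) * n.+1%:R).
    apply: le_trans h _; rewrite ler_pM2l// N2.
    have := ler_norm beta; have : `|beta| <= `|beta| * n.+1%:R by rewrite ler_peMr.
    lra.
  move=> h; rewrite /C ler_pdivlMr// ler_pdivlMr//.
  by rewrite -(ler_pM2r N0); lra.
rewrite -(cvg_shiftS mu1).
apply: (@squeeze_cvgr _ _ _ _ (fun=> 0) (fun n => C * n.+1%:R^-1)).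
- by apply: nearW => n; rewrite mu_ge0 mu_le.
- exact: cvg_cst.
- by rewrite -[X in _ --> X](mulr0 C); apply: cvgMr; exact: cvg_harmonic.
Qed.
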